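(* Let $q\ge2$, $k\ge 3$ and let $w,w'\in[q]^k$ be any words. Suppose that condition $D(w,w')$ holds, with witnessing permutations $\pi_i$ ($1\le i\le k-1$). Then $\tau_{w'}\prec_{\mathrm{st}}\tau_w$. Additionally, if for some $1\le i\le k-1$ and $a\in[q]$ we have a strict inequality $d_i(a)<d_i'(\pi_i(a))$, then $\tau_w$ and $\tau_{w'}$ are not equal in distribution.
   Context: $[q]=\{0,\dots,q-1\}$. For $w=w_1\cdots w_k\in[q]^k$, $a\in[q]$ and $1\le i\le k-1$, let $d_i(a)=\max\{j : 1\le j\le i+1,\ w_1w_2\cdots w_j = w_{i-j+2}w_{i-j+3}\cdots w_i a\}$ (the length of the longest prefix of $w$ that is a suffix of $w_1\cdots w_i a$), with $d_i(a)=*a$ (a formal symbol) if the set of such $j$ is empty. Let $d_i'$ denote the corresponding function for the word $w'$. By convention $*a<j$ for every $a\in[q]$ and every integer $j\ge1$, and all symbols $*a$, $*b$ are regarded as equal for the purposes of comparison. Condition $D(w,w')$: for each $i\in\{1,\dots,k-1\}$ there exists a permutation $\pi_i:[q]\to[q]$ such that $d_i(a)\le d_i'(\pi_i(a))$ for all $a\in[q]$. $\tau_w=\min\{t\in\mathbb N: Y_{t-k+1}Y_{t-k+2}\cdots Y_t=w\}$, where $(Y_i)_{i\in\mathbb N}$ (indices starting at $1$) are i.i.d. uniform on $[q]$; $\tau_{w'}$ is defined likewise. For real random variables $A,B$, $A\prec_{\mathrm{st}}B$ means $\mathbb P(A\ge t)\le\mathbb P(B\ge t)$ for all $t\in\mathbb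 R$. *)

(* Defs.v *)
From HB Require Import structures.
From mathcomp Require Import all_boot all_order all_algebra all_fingroup.
From mathcomp Require Import all_classical all_reals all_analysis.
From mathcomp Require Import measurable_realfun.
Set Implicit Arguments.
Unset Strict Implicit.
Unset Printing Implicit Defensive.
Import Order.TTheory GRing.Theory Num.Theory.

Local Open Scope classical_set_scope.
Local Open Scope ring_scope.

(* Values of d_i: an overlap length j >= 1, or the formal symbol *a. *)
Inductive dvalue (q : nat) : Type :=
  | Star of 'I_q
  | Len of nat.
Arguments Len {q} _.

(* All the symbols *a are equal for comparison and lie below every j >= 1;
   lengths occurring in [overlap] are positive, so 0 is free to rank them. *)
Definition drank (q : nat) (x : dvalue q) : nat :=
  match x with Star _ => 0%N | Len j => j end.

Definition dle (q : nat) (x y : dvalue q) : bool := (drank x <= drank y)%N.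
Definition dlt (q : nat) (x y : dvalue q) : bool := (drank x < drank y)%N.

Definition overlap_lengths (q k : nat) (w : k.-tuple 'I_q) (i : nat)
    (a : 'I_q) : seq nat :=
  [seq j <- iota 1 i.+1 | suffix (take j w) (rcons (take i w) a)].

(* d_i(a), meant for 1 <= i <= k - 1. *)
Definition overlap (q k : nat) (w : k.-tuple 'I_q) (i : nat) (a : 'I_q) :
    dvalue q :=
  if overlap_lengths w i a is [::] then Star a
  else Len (\max_(j <- overlap_lengths w i a) j).

Definition condD_witness (q k : nat) (w w' : k.-tuple 'I_q)
    (pi : nat -> {perm 'I_q}) : Prop :=
  forall i : nat, (1 <= i <= k.-1)%N ->
  forall a : 'I_q, dle (overlap w i a) (overlap w' i (pi i a)).

(* Sequences are indexed from 0: [Y i] is the letter Y_{i+1}.  Measurability is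
   with respect to the discrete sigma-algebra on the alphabet. *)
Definition iid_uniform (d : measure_display) (T : measurableType d)
    (R : realType) (P : probability T R) (q : nat) (Y : nat -> T -> 'I_q) :
    Prop :=
  [/\ forall (i : nat) (A : set 'I_q), measurable (Y i @^-1` A),
      forall (i : nat) (a : 'I_q), P (Y i @^-1` [set a]) = (q%:R^-1)%:E
    & forall (s : seq nat) (A : nat -> set 'I_q), uniq s ->
        P (\bigcap_(i in [set` s]) Y i @^-1` A i)
        = (\prod_(i <- s) P (Y i @^-1` A i))%E].

(* Y_{t-k+1} ... Y_t = w, where t >= k because indices start at 1. *)
Definition word_ends_at (T : Type) (q k : nat) (Y : nat -> T -> 'I_q)
    (w : k.-tuple 'I_q) (t : nat) (x : T) : Prop :=
  (k <= t)%N /\ [seq Y i x | i <- iota (t - k) k] = w.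

(* The least such t, and +oo if there is none. *)
Definition tau (R : realType) (T : Type) (q k : nat) (Y : nat -> T -> 'I_q)
    (w : k.-tuple 'I_q) (x : T) : \bar R :=
  ereal_inf [set (t%:R)%:E | t in [set t : nat | word_ends_at Y w t x]].

Definition st_le (d : measure_display) (T : measurableType d) (R : realType)
    (P : probability T R) (A B : T -> \bar R) : Prop :=
  forall t : R,
    (P [set x | (t%:E <= A x)%E] <= P [set x | (t%:E <= B x)%E])%E.

Definition eq_in_law (d : measure_display) (T : measurableType d)
    (R : realType) (P : probability T R) (A B : T -> \bar R) : Prop :=
  forall S : set (\bar R), measurable S -> P (A @^-1` S) = P (B @^-1` S).

(* Main.v *)
Require Import Defs.
From HB Require Import structures.
From mathcomp Require Import all_boot all_order all_algebra all_fingroup.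
From mathcomp Require Import all_classical all_reals all_analysis.
From mathcomp Require Import measurable_realfun zify.
Set Implicit Arguments.
Unset Strict Implicit.
Unset Printing Implicit Defensive.
Import Order.TTheory GRing.Theory Num.Theory.

(** Reading the letters Y_1, Y_2, ... while remembering only the length of the
    longest prefix of w that is a suffix of what has been read (the
    Knuth-Morris-Pratt automaton of w) turns tau_w into the absorption time at k
    of a chain on {0, ..., k}: from state i, the letter a leads to d_i(a), the
    symbols *a standing for state 0 ([survives_avoids]).  Since the letters are
    i.i.d. uniform, P(tau_w > n) is q^-n times the number of texts of length n
    that leave the chain unabsorbed when it starts at 0 ([prob_le_tau]); call
    U_n(i) this number for the start i.

    The chain climbs by at most one step at a time.  To be absorbed from i <= j
    it must therefore pass through j, so U_n is nonincreasing in the state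
    ([survivors_antitone]).  This is what makes the two chains comparable, even
    though the law of the next state need not be monotone in the current one.
    By induction on n,
      U'_(n+1)(i) = sum_a U'_n(d'_i(pi_i a)) <= sum_a U_n(d'_i(pi_i a))
                 <= sum_a U_n(d_i(a)) = U_(n+1)(i),
    which is the stochastic domination ([survivors_dominated]).  State 0, on
    which the hypothesis is silent, is handled by a permutation exchanging the
    first letters of w and w'.

    If j = d_i(a) < j' = d'_i(pi_i a), then k - j' letters never suffice to
    absorb the first chain from j, whereas spelling the rest of w' absorbs the
    second one from j'.  So U' is strictly smaller than U at i for one length of
    text; as the state i can be reached from 0 by climbing, the strict
    inequality propagates down to 0 ([survivors_dominated_strict]), and the two
    laws give different masses to a half-line. *)

(** * Absorption of chains driven by uniform letters *)

Lemma sum_ltn (A : finType) (F G : A -> nat) (a0 : A) :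
  (forall a, F a <= G a) -> F a0 < G a0 -> \sum_a F a < \sum_a G a.
Proof.
move=> leFG ltFG; rewrite (bigD1 a0) //= [ltnRHS](bigD1 a0) //= -addSn.
by apply: leq_add => //; apply: leq_sum => a _; apply: leFG.
Qed.

Fixpoint survives (A : Type) (delta : nat -> A -> nat) (k i : nat)
    (s : seq A) : bool :=
  (i < k) && (if s is a :: s' then survives delta k (delta i a) s' else true).

(** Up to the factor #|A|^n, the probability that the chain driven by i.i.d.
    uniform letters and started at i is not absorbed after n steps.  Counting
    keeps all the comparisons of chains in nat. *)
Definition survivors (A : finType) (delta : nat -> A -> nat)
    (k n i : nat) : nat :=
  #|[set s : n.-tuple A | survives delta k i s]|.

Definition skip_free (A : Type) (delta : nat -> A -> nat) (k : nat) : Prop :=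
  forall i a, i < k -> delta i a <= i.+1.

Definition can_climb (A : Type) (delta : nat -> A -> nat) (k : nat) : Prop :=
  forall i, i < k -> exists a, delta i a = i.+1.

Section Chain.
Variables (A : finType) (delta : nat -> A -> nat) (k : nat).
Local Notation U := (survivors delta k).
Hypothesis A_gt0 : 0 < #|A|.

Lemma survivors0 i : U 0 i = (i < k).
Proof.
rewrite /survivors; have [ik|ki] := ltnP i k; last first.
  by apply: eq_card0 => s; rewrite tuple0 inE /= ltnNge ki.
rewrite (@eq_card _ _ predT) ?card_tuple // => s.
by rewrite tuple0 !inE /= ik.
Qed.

Lemma survivors_absorbed n i : k <= i -> U n i = 0.
Proof.
move=> ki; apply: eq_card0 => s; rewrite inE; case: s => -[|a s] ? /=;
by rewrite ltnNge ki.
Qed.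

Lemma survivorsS n i : i < k -> U n.+1 i = \sum_a U n (delta i a).
Proof.
move=> ik; rewrite /survivors -sum1_card big_mkcond /=.
under [RHS]eq_bigr => a _ do rewrite -sum1_card big_mkcond /=.
rewrite pair_bigA /=.
rewrite (reindex (fun p : A * n.-tuple A => [tuple of p.1 :: p.2])) /=.
  by apply: eq_bigr => -[a s] _; rewrite !inE /= ik.
exists (fun s : n.+1.-tuple A => (thead s, behead_tuple s)).
  by move=> [a s] _; congr pair; apply: val_inj.
by move=> s _; rewrite [RHS]tuple_eta; apply: val_inj.
Qed.

Lemma survivors_le n i : U n i <= #|A| ^ n.
Proof. by rewrite -card_tuple max_card. Qed.

Lemma survivors_time m n i : m <= n -> U n i <= #|A| ^ (n - m) * U m i.
Proof.
elim: m n i => [|m IH] n i.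
  rewrite subn0 survivors0; case: (ltnP i k) => ik _.
    by rewrite muln1 survivors_le.
  by rewrite survivors_absorbed.
case: n => // n; rewrite ltnS subSS => mn.
case: (ltnP i k) => ik; last by rewrite survivors_absorbed.
by rewrite !survivorsS // big_distrr leq_sum // => a _; apply: IH.
Qed.

(** The time index m <= n is what makes the induction work: while the chain from
    i has not reached j it can only waste letters, and it enters j with at most
    n letters left to read. *)
Lemma survivors_antitone m n i j : skip_free delta k ->
  m <= n -> i <= j -> U n j <= #|A| ^ (n - m) * U m i.
Proof.
move=> sf; elim: m i => [|m IH] i mn ij.
  rewrite subn0 survivors0; case: (ltnP i k) => ik.
    by rewrite muln1 survivors_le.
  by rewrite survivors_absorbed // (leq_trans ik).
have [ik|ki] := ltnP i k; last by rewrite survivors_absorbed ?(leq_trans ki).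
(* Once at j, only the decrease in time is left; below j, one step of a skip-free
   chain does not overshoot j. *)
move: ij; rewrite leq_eqVlt => /predU1P[<-|ij]; first exact: survivors_time.
rewrite survivorsS // -(leq_pmul2l A_gt0) mulnA -expnS -subSn // subSS.
rewrite big_distrr /= -sum_nat_const leq_sum // => a _.
apply: IH; first exact: ltnW.
exact: leq_trans (sf _ _ ik) ij.
Qed.

Corollary survivors_antitone_state n i j : skip_free delta k ->
  i <= j -> U n j <= U n i.
Proof.
by move=> sf /(survivors_antitone sf (leqnn n)); rewrite subnn mul1n.
Qed.

(** Too few letters are left for a skip-free chain to climb up to k. *)
Lemma survivors_full n i : skip_free delta k -> i + n < k -> U n i = #|A| ^ n.
Proof.
move=> sf; elim: n i => [|n IH] i; first by rewrite addn0 survivors0 => ->.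
move=> ink; have ik : i < k by apply: leq_ltn_trans ink; apply: leq_addr.
rewrite survivorsS // expnS -sum_nat_const; apply: eq_bigr => a _.
apply: IH; apply: leq_ltn_trans ink; rewrite addnS -addSn leq_add2r.
exact: sf.
Qed.

(** The text that climbs at each step is absorbed exactly at its end. *)
Lemma survivors_deficit n i : can_climb delta k -> i + n = k -> U n i < #|A| ^ n.
Proof.
move=> climb; elim: n i => [|n IH] i ink.
  by rewrite survivors0 -ink addn0 ltnn.
have ik : i < k by rewrite -ink addnS ltnS leq_addr.
have [a da] := climb i ik.
rewrite survivorsS // expnS -sum_nat_const; apply: (@sum_ltn _ _ _ a) => [b|].
  exact: survivors_le.
by rewrite da; apply: IH; rewrite addSnnS.
Qed.

End Chain.

(** * Comparison of two chains *)

Section Comparison.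
Variables (A : finType) (delta delta' : nat -> A -> nat) (k : nat).
Variable pi : nat -> {perm A}.
Local Notation U := (survivors delta k).
Local Notation U' := (survivors delta' k).
Hypothesis A_gt0 : 0 < #|A|.
Hypothesis sf : skip_free delta k.
Hypothesis dom : forall i a, i < k -> delta i a <= delta' i (pi i a).

Lemma survivorsS_perm n i : i < k -> U' n.+1 i = \sum_a U' n (delta' i (pi i a)).
Proof. by move=> ik; rewrite survivorsS // (reindex_perm (pi i)). Qed.

(** The induction hypothesis moves from delta' to delta at a fixed state; the
    state is then lowered within the chain delta. *)
Lemma survivors_dominated n i : U' n i <= U n i.
Proof.
elim: n i => [|n IH] i; first by rewrite !survivors0.
have [ik|ki] := ltnP i k; last by rewrite survivors_absorbed.
rewrite survivorsS_perm // survivorsS // leq_sum // => a _.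
exact: leq_trans (IH _) (survivors_antitone_state A_gt0 _ sf (dom a ik)).
Qed.

Hypothesis sf' : skip_free delta' k.
Hypothesis climb' : can_climb delta' k.

Lemma survivors_dominated_step n i a : i < k ->
  U' n (delta' i (pi i a)) < U n (delta i a) -> U' n.+1 i < U n.+1 i.
Proof.
move=> ik lt; rewrite survivorsS_perm // survivorsS //.
apply: (sum_ltn _ lt) => b.
apply: leq_trans (survivors_dominated _ _) _.
by apply: survivors_antitone_state => //; apply: dom.
Qed.

(** The strict inequality appears at i for texts of length k - j' + 1, where
    j' is the larger target, and is then carried down one state at a time: from
    each state below i some letter of the second chain climbs. *)
Lemma survivors_dominated_strict i a : i < k ->
  delta i a < delta' i (pi i a) -> exists n, U' n 0 < U n 0.
Proof.
move=> ik lt.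
have [n ltn] : exists n, U' n i < U n i.
  have j'k : delta' i (pi i a) <= k by apply: leq_trans (sf' _ ik) ik.
  exists (k - delta' i (pi i a)).+1; apply: (@survivors_dominated_step _ _ a) => //.
  rewrite (survivors_full sf); last by rewrite -{2}(subnKC j'k) ltn_add2r.
  by apply: survivors_deficit climb' _; rewrite subnKC.
elim: i ik n ltn {a lt} => [|i IH] ik n ltn; first by exists n.
have ik' := ltnW ik.
have [a da] := climb' ik'.
apply: (IH ik' n.+1); apply: (@survivors_dominated_step _ _ ((pi i)^-1%g a)) => //.
rewrite permKV da; apply: (leq_trans ltn).
by apply: survivors_antitone_state => //; apply: sf.
Qed.

End Comparison.

(** * The Knuth-Morris-Pratt automaton of a word *)

Lemma suffix_suffix (A : eqType) (u v y : seq A) :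
  suffix u y -> suffix v y -> size u <= size v -> suffix u v.
Proof.
move=> su sv uv; have vy := size_suffix sv.
move: su sv; rewrite !suffixE => /eqP su /eqP sv.
have dE : size v - size u + (size y - size v) = size y - size u by lia.
by rewrite -{2}sv drop_drop dE su.
Qed.

Section Automaton.
Variables (q k : nat) (w : k.-tuple 'I_q).

Definition kmp_step (i : nat) (a : 'I_q) : nat := drank (overlap w i a).

Lemma kmp_stepE i a : kmp_step i a = \max_(j <- overlap_lengths w i a) j.
Proof. by rewrite /kmp_step /overlap; case: overlap_lengths => //=; rewrite big_nil. Qed.

Lemma mem_overlap_lengths i a j : (j \in overlap_lengths w i a) =
  (0 < j <= i.+1) && suffix (take j w) (rcons (take i w) a).
Proof. by rewrite mem_filter mem_iota andbC add1n ltnS. Qed.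

Lemma kmp_step_max i a j : j <= i.+1 ->
  suffix (take j w) (rcons (take i w) a) -> j <= kmp_step i a.
Proof.
case: j => // j ji sj; rewrite kmp_stepE.
apply: (@leq_bigmax_seq _ _ xpredT id) => //.
by rewrite mem_overlap_lengths ji.
Qed.

Lemma kmp_step_attained i a :
  kmp_step i a <= i.+1 /\ suffix (take (kmp_step i a) w) (rcons (take i w) a).
Proof.
rewrite kmp_stepE; set l := overlap_lengths w i a.
have : {subset l <= overlap_lengths w i a} by [].
elim: l => [|j l IH] sub; first by rewrite big_nil take0 suffix0s.
rewrite big_cons /maxn; case: ifP => _.
  by apply: IH => x xl; apply: sub; rewrite inE xl orbT.
have := sub j (mem_head _ _).
by rewrite mem_overlap_lengths => /andP[/andP[_ ->] ->].
Qed.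

Lemma kmp_step_skip_free : skip_free kmp_step k.
Proof. by move=> i a _; have [] := kmp_step_attained i a. Qed.

Lemma kmp_step_letter i (ik : i < k) : kmp_step i (tnth w (Ordinal ik)) = i.+1.
Proof.
apply/eqP; rewrite eqn_leq kmp_step_skip_free //=; apply: kmp_step_max => //.
set b := tnth w _; have wb : nth b w i = b by rewrite [RHS](tnth_nth b).
by rewrite (take_nth b) ?size_tuple // wb suffix_refl.
Qed.

Lemma kmp_step_can_climb : can_climb kmp_step k.
Proof. by move=> i ik; exists (tnth w (Ordinal ik)); apply: kmp_step_letter. Qed.

(** Any other letter breaks the current match, so it cannot be extended. *)
Lemma kmp_step_other_letter i (ik : i < k) a :
  a != tnth w (Ordinal ik) -> kmp_step i a <= i.
Proof.
move=> ne; have [le suf] := kmp_step_attained i a.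
move: le suf; rewrite leq_eqVlt => /predU1P[->|//].
rewrite (take_nth a) ?size_tuple // suffix_rcons => /andP[/eqP wa _].
by rewrite (tnth_nth a) /= wa eqxx in ne.
Qed.

Definition longest_match (y : seq 'I_q) (i : nat) : Prop :=
  [/\ i <= k, suffix (take i w) y
    & forall j, j <= k -> suffix (take j w) y -> j <= i].

Lemma longest_match_nil : longest_match [::] 0.
Proof.
split=> // [|j jk]; first by rewrite take0.
by rewrite suffixs0 -size_eq0 size_takel ?size_tuple // leqn0.
Qed.

(** A prefix w_1 ... w_j a matched after reading a extends a match of length j
    that was already there, hence j <= i and that match lies inside w_1 ... w_i:
    the state i retains all that is needed about y. *)
Lemma longest_match_rcons y i a : i < k ->
  longest_match y i -> longest_match (rcons y a) (kmp_step i a).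
Proof.
move=> ik [_ suf mx]; have [le nsuf] := kmp_step_attained i a; split.
- exact: leq_trans le ik.
- apply: (suffix_trans nsuf).
  by rewrite suffix_rcons eqxx.
case=> // j jk; rewrite (take_nth a) ?size_tuple // suffix_rcons.
move=> /andP[/eqP wa sj].
have ji := mx j (ltnW jk) sj.
apply: kmp_step_max => //.
rewrite (take_nth a) ?size_tuple // suffix_rcons wa eqxx /=.
by apply: (suffix_suffix sj suf); rewrite !size_takel ?size_tuple // ltnW.
Qed.

Lemma longest_match_full y i : longest_match y i -> (i < k) = ~~ suffix w y.
Proof.
have takek : take k w = w :> seq _ by rewrite take_oversize ?size_tuple.
case=> ik suf mx; rewrite ltnNge; congr (~~ _).
apply/idP/idP => [ki|sw]; last by apply: mx; rewrite ?takek.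
by move: suf; rewrite (@anti_leq i k) ?ik // takek.
Qed.

(** Non-absorption from the state of y means that w does not end anywhere in s
    when s is read after y. *)
Lemma survives_avoids y i s : longest_match y i ->
  survives kmp_step k i s <->
  (forall n, n <= size s -> ~~ suffix w (y ++ take n s)).
Proof.
elim: s y i => [|a s IH] y i lm /=; rewrite (longest_match_full lm).
  rewrite andbT; split=> [nw n _|]; first by rewrite cats0.
  by move/(_ 0 isT); rewrite cats0.
have [sw|nw] := boolP (suffix w y).
  by split=> //= /(_ 0 isT); rewrite cats0 sw.
have ik : i < k by rewrite (longest_match_full lm).
rewrite /= (IH _ _ (longest_match_rcons a ik lm)); split=> avoid.
  by case=> [|n] ns; rewrite ?cats0 //= -cat_rcons; apply: avoid.
by move=> n ns; rewrite cat_rcons; apply: (avoid n.+1).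
Qed.

End Automaton.

(** * Distribution of the hitting time *)

(** Reduces the real thresholds of the stochastic order to integer times. *)
Lemma ltr_nat_ceil (R : realType) (t : R) :
  exists n : nat, forall m : nat, (m%:R < t)%R = (m < n).
Proof.
exists (if Num.ceil t is Posz n then n else 0) => m.
have := ceil_gt_int t m; rewrite -pmulrn => <-.
by case: (Num.ceil t) => n.
Qed.

Section Probability.
Local Open Scope classical_set_scope.
Local Open Scope ring_scope.
Variables (R : realType) (d : measure_display) (T : measurableType d).
Variables (P : probability T R) (q : nat) (Y : nat -> T -> 'I_q).
Hypothesis hY : iid_uniform P Y.

Definition first_letters n (x : T) :
    n.-tuple 'I_q := [tuple of [seq Y i x | i <- iota 0 n]].

Lemma first_lettersE n (s : n.-tuple 'I_q) (a0 : 'I_q) :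
  [set x | first_letters n x = s] =
  \bigcap_(i in [set` iota 0 n]) Y i @^-1` [set nth a0 s i].
Proof.
apply/seteqP; split=> x /=.
  move=> <- i /=; rewrite mem_iota add0n => ik.
  by rewrite (nth_map 0%N) ?size_iota // nth_iota.
move=> h; apply/val_inj/(@eq_from_nth _ a0) => [|i]; first by rewrite !size_tuple.
rewrite size_tuple => ik; rewrite (nth_map 0%N) ?size_iota // nth_iota //.
by apply: h => /=; rewrite mem_iota.
Qed.

Lemma measurable_first_letters_eq n (s : n.-tuple 'I_q) :
  measurable [set x | first_letters n x = s].
Proof.
(* The empty text is treated apart: it provides no default letter. *)
case: n s => [|n] s.
  suff -> : [set x | first_letters 0 x = s] = setT by exact: measurableT.
  by apply/seteqP; split=> // x _ /=; rewrite (tuple0 s); apply: val_inj.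
rewrite (first_lettersE s (thead s)); apply: fin_bigcap_measurable => //.
by move=> i _; case: hY.
Qed.

Lemma prob_first_letters_eq n (s : n.-tuple 'I_q) :
  P [set x | first_letters n x = s] = (q%:R^-1 ^+ n)%:E.
Proof.
case: n s => [|n] s.
  rewrite expr0 (_ : [set _ | _] = setT) ?probability_setT //.
  by apply/seteqP; split=> // x _ /=; rewrite (tuple0 s); apply: val_inj.
rewrite (first_lettersE s (thead s)); case: hY => _ unif -> //; last exact: iota_uniq.
under eq_bigr => i _ do rewrite unif.
by rewrite prodEFin big_const_seq count_predT size_iota iter_mulr_1.
Qed.

Lemma prob_first_letters n (E : {set n.-tuple 'I_q}) :
  P [set x | first_letters n x \in E] = (#|E|%:R / q%:R ^+ n)%:E.
Proof.
have -> : [set x | first_letters n x \in E] =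
    \bigcup_(s in [set` enum E]) [set x | first_letters n x = s].
  apply/seteqP; split=> x /=.
    by move=> h; exists (first_letters n x); rewrite //= mem_enum.
  by case=> s /=; rewrite mem_enum => sE ->.
rewrite measure_fin_bigcup //; last 2 first.
- by move=> s s' _ _ [x [/= <- <-]].
- by move=> s _; apply: measurable_first_letters_eq.
rewrite -fsbig_seq ?enum_uniq //.
rewrite (eq_bigr (fun=> (q%:R^-1 ^+ n)%:E)); last first.
  by move=> s _; apply: prob_first_letters_eq.
by rewrite sumEFin big_const_seq count_predT -cardE iter_addr_0 mulr_natl exprVn.
Qed.

Variables (k : nat) (w : k.-tuple 'I_q).
Hypothesis k_gt0 : (0 < k)%N.

Lemma word_ends_atE t x :
  word_ends_at Y w t x <-> suffix w [seq Y i x | i <- iota 0 t].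
Proof.
rewrite /word_ends_at suffixE size_map size_iota size_tuple -map_drop drop_iota.
have [kt|tk] := leqP k t; first by rewrite subKn // add0n; split=> [[_ ->]|/eqP ->].
split=> [[]//|/eqP/(congr1 size)]; rewrite size_map size_iota size_tuple; lia.
Qed.

Lemma le_tauE (t : R) x : (t%:E <= tau R Y w x)%E <->
  forall n : nat, n%:R < t -> ~ word_ends_at Y w n x.
Proof.
split=> [/ereal_infP h n nt wn|h].
  have : (t%:E <= n%:R%:E)%E by apply: h; exists n.
  by rewrite lee_fin leNgt nt.
apply/ereal_infP => _ [n wn <-]; rewrite lee_fin leNgt; apply/negP => nt.
exact: h nt wn.
Qed.

(** The event tau_w >= n depends only on the first n - 1 letters; for n = 0
    the truncated predecessor is harmless, as w is not the empty word. *)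
Lemma le_tau_survives (t : R) n x : (forall m, m%:R < t = (m < n)%N) ->
  (t%:E <= tau R Y w x)%E <-> survives (kmp_step w) k 0 (first_letters n.-1 x).
Proof.
move=> tn; rewrite le_tauE (survives_avoids _ (longest_match_nil w)).
rewrite size_tuple; split=> avoid m; last first.
  rewrite tn => mn; rewrite word_ends_atE.
  have mn' : (m <= n.-1)%N by lia.
  by have := avoid m mn'; rewrite /= -map_take take_iota (minn_idPl mn') => /negP.
move=> mn; rewrite /= -map_take take_iota (minn_idPl mn).
case: m mn => [|m] mn.
  rewrite suffixs0 -size_eq0 size_tuple; lia.
by apply/negP; rewrite -word_ends_atE; apply: avoid; rewrite tn; lia.
Qed.

Lemma prob_le_tau (t : R) n : (forall m, m%:R < t = (m < n)%N) ->
  P [set x | (t%:E <= tau R Y w x)%E] =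
  ((survivors (kmp_step w) k n.-1 0)%:R / q%:R ^+ n.-1)%:E.
Proof.
move=> tn; rewrite /survivors -prob_first_letters; congr (P _).
by apply/seteqP; split=> x /=; rewrite inE => /(le_tau_survives _ tn).
Qed.

End Probability.

Theorem theorem3p12 (R : realType) (d : measure_display)
    (T : measurableType d) (P : probability T R) (q k : nat)
    (hq : (2 <= q)%N) (hk : (3 <= k)%N)
    (Y : nat -> T -> 'I_q) (hY : iid_uniform P Y)
    (w w' : k.-tuple 'I_q) (pi : nat -> {perm 'I_q})
    (hD : condD_witness w w' pi) :
  st_le P (tau R Y w') (tau R Y w) /\
  ((exists (i : nat) (a : 'I_q), (1 <= i <= k.-1)%N /\
      dlt (overlap w i a) (overlap w' i (pi i a))) ->
   ~ eq_in_law P (tau R Y w) (tau R Y w')).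
Proof.
have k_gt0 : 0 < k by lia.
have A_gt0 : 0 < #|'I_q| by rewrite card_ord; lia.
pose first (v : k.-tuple 'I_q) := tnth v (Ordinal k_gt0).
(* At state 0 both chains move to 1 on the first letter of their word and stay
   at 0 on the others, so matching the first letters gives equality. *)
pose sigma i := if i is 0 then tperm (first w) (first w') else pi i.
have dom i a : i < k -> kmp_step w i a <= kmp_step w' i (sigma i a).
  case: i => [|i] ik; last by apply: hD; lia.
  rewrite /sigma; have [->|ne] := eqVneq a (first w).
    by rewrite tpermL !kmp_step_letter.
  by apply: leq_trans (kmp_step_other_letter ne) _.
split=> [t|[i [a [ik lt]]] law].
  have [n tn] := ltr_nat_ceil t.
  rewrite !(prob_le_tau hY _ k_gt0 tn) lee_fin ler_wpM2r ?invr_ge0 ?exprn_ge0 //.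
  rewrite ler_nat; apply: survivors_dominated A_gt0 (@kmp_step_skip_free _ _ w) dom _ _.
have [n] : exists n, survivors (kmp_step w') k n 0 < survivors (kmp_step w) k n 0.
  apply: (survivors_dominated_strict A_gt0 (@kmp_step_skip_free _ _ w) dom
    (@kmp_step_skip_free _ _ w') (@kmp_step_can_climb _ _ w') (i := i) (a := a)).
    by lia.
  by case: i ik lt.
(* The event tau >= n + 1, which depends on the first n letters, separates the
   two laws. *)
have tn m : (m%:R < n.+1%:R :> R)%R = (m < n.+1) by rewrite ltr_nat.
have := law `[n.+1%:R%:E, +oo[%classic (emeasurable_itv _).
have ev (v : k.-tuple 'I_q) : (tau R Y v @^-1` `[n.+1%:R%:E, +oo[)%classic
    = [set x | (n.+1%:R%:E <= tau R Y v x)%E]%classic.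
  by apply/seteqP; split=> x /=; rewrite in_itv /= andbT.
rewrite !ev !(prob_le_tau hY _ k_gt0 tn) => -[/mulIf].
have qn0 : ((q%:R ^+ n)^-1 != 0 :> R)%R.
  by rewrite invr_eq0 expf_neq0 // pnatr_eq0; lia.
by move=> /(_ qn0)/eqP; rewrite eqr_nat => /eqP ->; rewrite ltnn.
Qed.
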